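(* \[ \liminf_{n\to \infty} \frac{\sigma^*(\phi^*(n))}{n} \le \inf \left\{\frac{\sigma^*(\phi^*(m/2))}{m/2} : m \text{ a positive even integer},\ m\ne 2^{\ell} \text{ for every integer } \ell \ge 2 \right\}, \] and \[ \liminf_{n\to \infty} \frac{\sigma^*(\phi^*(n))}{n} \le \frac14 + \varepsilon, \qquad \text{where } \varepsilon = \frac{3}{4(2^{32}-1)}. \]
   Context: For $n=p_1^{a_1}\cdots p_r^{a_r}$ the prime factorization of $n>1$, $\sigma^*(n)=(p_1^{a_1}+1)\cdots(p_r^{a_r}+1)$ is the sum of unitary divisors of $n$ (divisors $d$ with $\gcd(d,n/d)=1$) and $\phi^*(n)=(p_1^{a_1}-1)\cdots(p_r^{a_r}-1)$ is the unitary Euler function; $\sigma^*(1)=\phi^*(1)=1$. *)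

(* Defs.v *)
From HB Require Import structures.
From mathcomp Require Import all_boot all_order all_algebra.
From mathcomp Require Import all_classical all_reals ereal topology sequences.

Set Implicit Arguments.
Unset Strict Implicit.
Unset Printing Implicit Defensive.

Import Order.TTheory GRing.Theory Num.Theory.

Local Open Scope ring_scope.

(* [primes n] is duplicate-free and [logn p n] is the exponent of [p] in [n],
   so both products run over the prime-power components of [n]; they are empty,
   hence equal to 1, at n = 1. The value 1 at n = 0 is a junk value. *)
Definition usigma (n : nat) : nat :=
  (\prod_(p <- primes n) (p ^ logn p n + 1))%N.

(* The truncated subtraction is harmless: every factor [p ^ logn p n] is at
   least 2. *)
Definition uphi (n : nat) : nat :=
  (\prod_(p <- primes n) (p ^ logn p n - 1))%N.

(* At n = 0 the division yields the junk value 0. *)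
Definition usigma_uphi_ratio (R : realType) (n : nat) : R :=
  (usigma (uphi n))%:R / n%:R.

(* Main.v *)
Require Import Defs.
From HB Require Import structures.
From mathcomp Require Import all_boot all_order all_algebra.
From mathcomp Require Import all_classical all_reals ereal topology sequences.
From mathcomp Require Import zify ring lra.

(* Write f for the ratio sigma*(phi*(n))/n. For a fixed N > 0 there are
   arbitrarily large n with f(n) <= f(N) + eps, namely n = N c with c the
   product of a suitable nonempty finite set Q of primes > N. Indeed
   phi*(N c) = phi*(N) b with b the product of the q - 1 for q in Q, and sigma*
   is submultiplicative, so f(N c) <= f(N) sigma*(b)/b, and it suffices to find
   Q with sigma*(b)/b close to 1, that is, with the sum over primes r | b of
   r^(-v_r(b)) small.

   Fix A and y >= N, and let z > y have pi(z)/z small. Start from the first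
   A pi(z) + 1 primes > y and, as long as some prime r <= z divides q - 1 for at
   least one and fewer than A of the remaining q, discard these q. Each r causes
   this at most once, so fewer than A pi(z) + 1 primes are discarded and a
   nonempty Q remains. Every prime r <= z dividing b now has v_r(b) >= A, and
   every prime r > z dividing b is one of the initial A pi(z) + 1 primes, so the
   sum is at most sum_r r^(-A) + (A pi(z) + 1)/z.

   The explicit bound is f(2 (2^32 - 1)), since 2^32 - 1 is the product of the
   five Fermat primes 3, 5, 17, 257 and 65537, whence phi* = 2^31. *)

Set Implicit Arguments.
Unset Strict Implicit.
Unset Printing Implicit Defensive.

Import Order.TTheory GRing.Theory Num.Theory.

Local Open Scope classical_set_scope.
Local Open Scope ring_scope.

Section NatPart.
Local Open Scope nat_scope.

(** * Sparsity of the primes, after Chebyshev *)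

Lemma prime_dvd_fact p n : prime p -> p %| n`! -> p <= n.
Proof.
move=> p_pr; elim: n => [|n IHn].
  by rewrite fact0 dvdn1 => /eqP p1; rewrite p1 in p_pr.
rewrite factS Euclid_dvdM // => /orP[/dvdn_leq -> //|/IHn /leq_trans]; exact.
Qed.

Lemma leq_bin_pow2 n m : 'C(n, m) <= 2 ^ n.
Proof.
elim: n m => [|n IHn] [|m]; rewrite ?bin0 ?expn_gt0 ?bin0n //.
by rewrite binS expnS mul2n -addnn leq_add.
Qed.

Lemma prod_primes_dvd (s : seq nat) m :
  uniq s -> {in s, forall p, prime p && (p %| m)} -> \prod_(p <- s) p %| m.
Proof.
move=> s_uniq sP; apply/unstable.Gauss_dvd_prod; last by move=> p /sP /andP[].
rewrite filter_predT map_id.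
apply: (sub_in_pairwise (P := mem s)) (_ : pairwise [rel x y | x != y] s).
- move=> p q /sP/andP[p_pr _] /sP/andP[q_pr _] /= neq_pq.
  by rewrite prime_coprime // dvdn_prime2.
- by apply/allP.
- by rewrite -uniq_pairwise.
Qed.

(* Chebyshev: every prime in (n, 2n] divides 'C(2n, n) <= 4 ^ n. *)
Lemma exp_count_primes_leq n :
  n ^ count prime (iota n.+1 n) <= 2 ^ (n + n).
Proof.
apply: leq_trans (leq_bin_pow2 (n + n) n).
apply: leq_trans (_ : \prod_(p <- iota n.+1 n | prime p) p <= _).
  rewrite -sum1_count (big_morph _ (expnD n) (expn0 n)).
  rewrite big_seq_cond [X in _ <= X]big_seq_cond; apply: leq_prod => p.
  by rewrite expn1 mem_iota => /andP[/andP[/ltnW]].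
apply: dvdn_leq; first by rewrite bin_gt0 leq_addr.
rewrite -big_filter; apply: prod_primes_dvd => [|p].
  by rewrite filter_uniq ?iota_uniq.
rewrite mem_filter mem_iota => /and3P[p_pr lt_np le_p]; rewrite p_pr /=.
have p_ndvd : ~~ (p %| n`!).
  by apply/negP => /(prime_dvd_fact p_pr); rewrite leqNgt lt_np.
have: p %| (n + n)`! by apply: dvdn_fact; lia.
rewrite -(bin_fact (leq_addr n n)) addnK Euclid_dvdM // => /orP[//|].
by rewrite Euclid_dvdM // (negPf p_ndvd).
Qed.

Definition prime_pi n := count prime (iota 0 n.+1).

Lemma prime_pi_leq n : prime_pi n <= n.
Proof.
by rewrite /prime_pi /= add0n (leq_trans (count_size _ _)) ?size_iota.
Qed.

(** Dyadic summation: for [j >= h] the Chebyshev bound on (2^j, 2^(j+1)] gives at most 2^(j+1) / h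
    primes, and these bounds add up geometrically. Below 2^h every integer is counted as if
    prime. *)
Lemma prime_pi_pow2 h i :
  h * prime_pi (2 ^ (h + i)) <= h * 2 ^ h + 2 ^ (h + i).+1.
Proof.
elim: i => [|i IHi].
  by rewrite addn0 (leq_trans _ (leq_addr _ _)) // leq_mul2l prime_pi_leq orbT.
rewrite addnS; set j := h + i in IHi *.
have -> : prime_pi (2 ^ j.+1) =
    prime_pi (2 ^ j) + count prime (iota (2 ^ j).+1 (2 ^ j)).
  by rewrite /prime_pi -count_cat -iotaD expnS mul2n -addnn.
have: h * count prime (iota (2 ^ j).+1 (2 ^ j)) <= 2 ^ j.+1.
  apply: leq_trans (_ : j * count prime (iota (2 ^ j).+1 (2 ^ j)) <= _).
    by rewrite leq_mul2r leq_addr orbT.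
  rewrite -(@leq_exp2l 2) // expnM (leq_trans (exp_count_primes_leq _)) //.
  by rewrite addnn -mul2n -expnS.
by rewrite mulnDr (expnS 2 j.+1); lia.
Qed.

Lemma primes_sparse y L : exists2 z, y < z & L * prime_pi z <= z.
Proof.
(* At z = 4^h the dyadic bound and h < 2^h give h pi(z) <= h 2^h + 2 * 4^h <= 3z, so h >= 3L
   suffices; the summand [y] ensures z > y. *)
pose h := 3 * L + y + 1.
have lt_h := @ltn_expl 2 h isT.
exists (2 ^ (h + h)).
  by rewrite (leq_trans _ (ltnW (@ltn_expl 2 (h + h) isT))) // /h; lia.
have := prime_pi_pow2 h h.
rewrite expnS expnD; set t := 2 ^ h in lt_h *; set c := prime_pi _.
have: 3 * L * c <= h * c by rewrite leq_mul2r /h -addnA leq_addr orbT.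
have: h * t <= t * t by rewrite leq_mul2r (ltnW lt_h) orbT.
by lia.
Qed.

(** * Segments of primes and trimming *)

(** The primes are taken as all those of one interval, so that a prime factor of some q - 1 lying
    above the left end belongs to the same list. *)
Lemma primes_initial_segment y K :
  exists x, size [seq p <- index_iota y x | prime p] = K.
Proof.
suff [x _ sz]: exists2 x, y <= x & size [seq p <- index_iota y x | prime p] = K.
  by exists x.
elim: K => [|K [x le_yx sz_x]].
  by exists y => //; rewrite /index_iota subnn.
have exP : exists p, (x <= p) && prime p.
  by have [p /ltnW le_xp p_pr] := prime_above x; exists p; rewrite le_xp.
case: (ex_minnP exP) => p /andP[le_xp p_pr] p_min.
exists p.+1; first by rewrite (leq_trans le_yx) // ltnW.
have -> : index_iota y p.+1 = index_iota y x ++ rcons (index_iota x p) p.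
  rewrite /index_iota -cats1 catA.
  have -> : p.+1 - y = (x - y) + ((p - x) + 1) by lia.
  by rewrite !iotaD catA !subnKC.
rewrite filter_cat size_cat sz_x filter_rcons p_pr size_rcons.
suff -> : [seq q <- index_iota x p | prime q] = [::] by rewrite addn1.
apply/eqP; rewrite -[_ == _]negbK -has_filter; apply/hasPn => q.
rewrite mem_index_iota => /andP[le_xq lt_qp]; apply/negP => q_pr.
by have := p_min q; rewrite le_xq q_pr leqNgt lt_qp => /(_ isT).
Qed.

(** Induction on [size R]: a bad [r] is dropped together with its fewer than [A] neighbours in [Q],
    which preserves the strict inequality. In later sublists [r] has no neighbour, so its condition
    holds vacuously. *)
Lemma trim_low_degree (T S : eqType) (e : S -> T -> bool) A
    (R : seq S) (Q : seq T) :
  A * size R < size Q ->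
  exists Q', [/\ subseq Q' Q, 0 < size Q' &
    {in R, forall r, has (e r) Q' -> A <= count (e r) Q'}].
Proof.
have [k] := ubnP (size R); elim: k R Q => // k IHk R Q ltRk lt_RQ.
have [good|] := boolP (all (fun r => has (e r) Q ==> (A <= count (e r) Q)) R).
  exists Q; split=> //; first by apply: leq_ltn_trans lt_RQ.
  by move=> r /(allP good)/implyP.
case/allPn=> r rR; rewrite negb_imply -ltnNge => /andP[_ lt_cA].
have szR : size R = (size (rem r R)).+1.
  by rewrite size_rem // prednK //; case: (R) rR.
have [||Q' [sQ'Q Q'_gt0 Q'P]] := IHk (rem r R) [seq q <- Q | ~~ e r q].
- by rewrite szR ltnS in ltRk.
- move: lt_RQ; rewrite -(count_predC (e r) Q) szR size_filter.
  rewrite mulnS (_ : count (predC (e r)) Q = count (fun q => ~~ e r q) Q) //.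
  by lia.
exists Q'; split=> //; first exact: subseq_trans sQ'Q (filter_subseq _ _).
move=> t tR; have [-> /hasP[q /(mem_subseq sQ'Q)]|neq_tr] := eqVneq t r.
  by rewrite mem_filter => /andP[/negPf->].
by apply: Q'P; move: tR; rewrite (perm_mem (perm_to_rem rR)) inE (negPf neq_tr).
Qed.

(** * Prime factors of the product of the q - 1 *)

Lemma prod_pred_primes_gt0 (Q : seq nat) :
  all prime Q -> 0 < \prod_(q <- Q) (q - 1).
Proof.
move=> Q_pr; rewrite big_seq; apply: prodn_cond_gt0 => q qQ.
by rewrite subn_gt0 prime_gt1 // (allP Q_pr).
Qed.

(** Turns the degree condition left by trimming into a lower bound on the exponent of [r]. *)
Lemma count_dvd_leq_logn r (Q : seq nat) : prime r -> all prime Q ->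
  count (fun q => r %| q - 1) Q <= logn r (\prod_(q <- Q) (q - 1)).
Proof.
move=> r_pr; elim: Q => [|q Q IHQ] /=; first by rewrite big_nil.
case/andP=> q_pr Q_pr.
have q1_gt0 : 0 < q - 1 by rewrite subn_gt0 prime_gt1.
rewrite big_cons lognM ?prod_pred_primes_gt0 // leq_add ?IHQ //.
case: (boolP (r %| q - 1)) => // r_q.
by rewrite logn_gt0 mem_primes r_pr q1_gt0.
Qed.

Lemma dvd_prod_pred_primes r (Q : seq nat) : prime r ->
  r %| \prod_(q <- Q) (q - 1) -> has (fun q => r %| q - 1) Q.
Proof.
move=> r_pr; elim: Q => [|q Q IHQ] /=.
  by rewrite big_nil dvdn1 => /eqP r1; rewrite r1 in r_pr.
by rewrite big_cons Euclid_dvdM // => /orP[->//|/IHQ->]; rewrite orbT.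
Qed.

(** * Behaviour of [usigma] and [uphi] on products *)

Lemma prod_primes_widen (F : nat -> nat) n s : uniq s ->
    {subset primes n <= s} ->
  \prod_(p <- primes n) F p =
  \prod_(p <- s) (if p \in primes n then F p else 1).
Proof.
move=> s_uniq sub_s; rewrite -big_mkcond -[RHS]big_filter; apply: perm_big.
apply: uniq_perm; rewrite ?primes_uniq ?filter_uniq // => p.
by rewrite mem_filter; case: (boolP (p \in primes n)) => // /sub_s.
Qed.

(** Compared prime by prime: if x and y are the p-parts of [a] and [b], then xy + 1 <= (x + 1)(y +
    1) when p divides both, and the factors agree when p divides only one. *)
Lemma usigma_submul a b : 0 < a -> 0 < b ->
  usigma (a * b) <= usigma a * usigma b.
Proof.
move=> a_gt0 b_gt0; have ab_uniq := primes_uniq (a * b).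
rewrite /usigma (prod_primes_widen _ (n := a) ab_uniq); last first.
  by move=> p; rewrite primesM // => ->.
rewrite (prod_primes_widen _ (n := b) ab_uniq); last first.
  by move=> p; rewrite primesM // => ->; rewrite orbT.
rewrite -big_split /= [leqLHS]big_seq [leqRHS]big_seq.
apply: leq_prod => p; rewrite primesM // lognM // expnD.
case: (boolP (p \in primes a)); case: (boolP (p \in primes b)) => //=.
- by rewrite mulnDl mul1n; lia.
- move=> /negPf; rewrite -logn_gt0 lt0n => /negbFE/eqP-> _.
  by rewrite expn0 !muln1.
- move=> _ /negPf; rewrite -logn_gt0 lt0n => /negbFE/eqP-> _.
  by rewrite expn0 !mul1n.
Qed.

Lemma usigma_prime_pow p k : prime p -> 0 < k -> usigma (p ^ k) = p ^ k + 1.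
Proof.
move=> p_pr k_gt0.
by rewrite /usigma primesX // primes_prime // big_seq1 pfactorK.
Qed.

Lemma uphi_gt0 n : 0 < uphi n.
Proof.
rewrite /uphi big_seq; apply: prodn_cond_gt0 => p p_n.
rewrite subn_gt0 -(exp1n (logn p n)) ltn_exp2r ?logn_gt0 //.
by move: p_n; rewrite mem_primes => /andP[/prime_gt1].
Qed.

Lemma uphiMprime q n : prime q -> 0 < n -> ~~ (q %| n) ->
  uphi (q * n) = (q - 1) * uphi n.
Proof.
move=> q_pr n_gt0 q_ndvd; have q_gt0 := prime_gt0 q_pr.
have q_notin : q \notin primes n by rewrite mem_primes (negPf q_ndvd) !andbF.
rewrite /uphi (perm_big (q :: primes n)) /=; last first.
  apply: uniq_perm; rewrite /= ?primes_uniq ?q_notin // => p.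
  by rewrite primesM // primes_prime // !inE.
rewrite big_cons lognM // logn_prime // eqxx.
have -> : logn q n = 0 by apply/eqP; rewrite -leqn0 leqNgt logn_gt0.
rewrite expn1; congr (_ * _); rewrite big_seq [RHS]big_seq.
apply: eq_bigr => p p_n; rewrite lognM // logn_prime //.
by case: eqVneq => // eq_qp; rewrite -eq_qp p_n in q_notin.
Qed.

Lemma uphiMprod_primes n (Q : seq nat) : 0 < n -> uniq Q ->
    {in Q, forall q, prime q && (n < q)} ->
  uphi ((\prod_(q <- Q) q) * n) = (\prod_(q <- Q) (q - 1)) * uphi n.
Proof.
move=> n_gt0; elim: Q => [|q Q IHQ] /=; first by rewrite !big_nil !mul1n.
case/andP=> q_notin Q_uniq QP; have /andP[q_pr lt_nq] := QP q (mem_head _ _).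
have QP' : {in Q, forall p, prime p && (n < p)}.
  by move=> p p_Q; apply: QP; rewrite inE p_Q orbT.
rewrite !big_cons -!mulnA uphiMprime // ?IHQ //.
  rewrite muln_gt0 n_gt0 andbT big_seq; apply: prodn_cond_gt0 => p /QP'.
  by case/andP=> /prime_gt0.
rewrite Euclid_dvdM // negb_or (gtnNdvd n_gt0 lt_nq) andbT.
apply/negP; rewrite big_seq => /(big_rec (fun m => q %| m -> False)); apply.
  by rewrite dvdn1 => /eqP q1; rewrite q1 in q_pr.
move=> p m p_Q IHm; rewrite Euclid_dvdM // => /orP[|//].
have /andP[p_pr _] := QP' p p_Q.
by rewrite dvdn_prime2 // => /eqP eq_qp; rewrite eq_qp p_Q in q_notin.
Qed.

End NatPart.

(** * Bounding [usigma n] by a sum over prime-power components *)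

(** Division-free form of prod (1 + 1/a_i) <= 1 / (1 - sum 1/a_i), meaningful also when the sum
    reaches 1. *)
Lemma one_sub_sum_inv_mul_prod (R : realFieldType) (I : eqType) (s : seq I)
    (a : I -> R) :
    {in s, forall i, 0 < a i} ->
  (1 - \sum_(i <- s) (a i)^-1) * \prod_(i <- s) (a i + 1) <= \prod_(i <- s) a i.
Proof.
move=> a_gt0.
(* The inductive step absorbs the extra product by comparing it with the product of the a_i + 1,
   hence the two additional invariants. *)
suff [_ _ //] : [/\ 0 <= \prod_(i <- s) a i,
    \prod_(i <- s) a i <= \prod_(i <- s) (a i + 1) &
    (1 - \sum_(i <- s) (a i)^-1) * \prod_(i <- s) (a i + 1)
      <= \prod_(i <- s) a i].
elim: s a_gt0 => [|i s IHs] a_gt0; first by rewrite !big_nil; split; lra.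
have ai_gt0 : 0 < a i by rewrite a_gt0 ?mem_head.
have [|P_ge0 leP leS] := IHs.
  by move=> j js; rewrite a_gt0 // inE js orbT.
rewrite !big_cons; set P := \prod_(_ <- _) a _ in P_ge0 leP leS *.
set P' := \prod_(_ <- _) _ in leP leS *; set S := \sum_(_ <- _) _ in leS *.
have aiV_gt0 : 0 < (a i)^-1 by rewrite invr_gt0.
split; first by rewrite mulr_ge0 // ltW.
  by apply: ler_pM => //; lra.
have -> : (1 - ((a i)^-1 + S)) * ((a i + 1) * P') =
    (a i + 1) * ((1 - S) * P') - (1 + (a i)^-1) * P'.
  by field; rewrite gt_eqF.
by nra.
Qed.

Lemma natr_primes_prod (R : realFieldType) n : (0 < n)%N ->
  n%:R = \prod_(p <- primes n) (p ^ logn p n)%:R :> R.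
Proof.
move=> n_gt0.
by rewrite {1}(prod_prime_decomp n_gt0) prime_decompE big_map natr_prod.
Qed.

Lemma usigma_upper (R : realFieldType) n : (0 < n)%N ->
  (1 - \sum_(p <- primes n) (p ^ logn p n)%:R^-1) * (usigma n)%:R <= n%:R :> R.
Proof.
move=> n_gt0; rewrite [leRHS]natr_primes_prod // /usigma natr_prod.
under [X in _ * X]eq_bigr => p _ do rewrite natrD.
apply: one_sub_sum_inv_mul_prod => p.
by rewrite mem_primes ltr0n expn_gt0 => /andP[/prime_gt0 ->].
Qed.

Lemma sum_inv_sqr_le1 (R : realFieldType) (s : seq nat) :
    uniq s -> all (leq 2) s ->
  \sum_(p <- s) (p%:R ^+ 2)^-1 <= 1 :> R.
Proof.
move=> s_uniq s_ge2; pose M := (\max_(p <- s) p).+2.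
have -> : \sum_(p <- s) (p%:R ^+ 2)^-1 =
    \sum_(2 <= p < M) (if p \in s then (p%:R ^+ 2)^-1 else 0) :> R.
  rewrite -big_mkcond -big_filter; apply: perm_big; apply: uniq_perm => //.
    by rewrite filter_uniq ?iota_uniq.
  move=> p; rewrite mem_filter; case: (boolP (p \in s)) => //= p_s.
  by rewrite mem_index_iota (allP s_ge2) //= /M ltnS leqW // leq_bigmax_seq.
(* Telescoping majorant: 1/p^2 <= 1/((p - 1)p) = 1/(p - 1) - 1/p. *)
apply: (@le_trans _ _ (\sum_(2 <= p < M) (- (p.+1.-1)%:R^-1 - - (p.-1)%:R^-1))).
  rewrite big_seq [leRHS]big_seq; apply: ler_sum => p.
  rewrite mem_index_iota => /andP[p_ge2 _].
  have [k ->] : exists k, p = k.+2 by exists (p - 2)%N; lia.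
  rewrite /= -[k.+2%:R]natr1; have : 1 <= k.+1%:R :> R by rewrite ler1n.
  move: (k.+1%:R) => x x_ge1.
  have -> : - (x + 1)^-1 - - x^-1 = (x * (x + 1))^-1.
    by field; apply/andP; split; apply: lt0r_neq0; lra.
  case: ifP => _; last by rewrite invr_ge0; nra.
  by rewrite lef_pV2 ?posrE; nra.
rewrite (telescope_sumr (fun p => - (p.-1)%:R^-1)) //= invr1 opprK.
by rewrite gerDr oppr_le0 invr_ge0 ler0n.
Qed.

(** * Choosing the primes and perturbing the ratio *)

Lemma exists_primes_usigma_prod_pred (R : realFieldType) L y :
  exists Q : seq nat, [/\ uniq Q, (0 < size Q)%N,
    {in Q, forall q, prime q && (y < q)%N} &
    (1 - 3 / 2 ^+ L) * (usigma (\prod_(q <- Q) (q - 1)))%:R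
      <= (\prod_(q <- Q) (q - 1))%:R :> R].
Proof.
(* Two exponents beyond [L] leave a convergent sum: p^(-A) <= 2^(-L) p^(-2), so the primes up to z
   contribute at most 1/2^L. *)
pose A := L.+2.
(* Since z exceeds 2^L and 2^L A pi(z) <= z, the primes above z contribute at most (A pi(z) + 1)/z
   <= 2/2^L. *)
have [z lt_z le_z] := primes_sparse (y + 2 ^ L) (2 ^ L * A).
pose K := (A * prime_pi z).+1.
have [x size_Q0] := primes_initial_segment y.+1 K.
set Q0 := [seq _ <- _ | _] in size_Q0.
pose S := [seq r <- iota 0 z.+1 | prime r].
have [|Q [sQ Q_gt0 QP]] :=
    @trim_low_degree _ _ (fun r q => r %| q - 1)%N A S Q0.
  by rewrite size_Q0 /K /S size_filter ltnS.
have QQ0 := mem_subseq sQ.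
have Q_pr : all prime Q by apply/allP => q /QQ0; rewrite mem_filter => /andP[].
exists Q; split=> //; first by rewrite (subseq_uniq sQ) ?filter_uniq ?iota_uniq.
  by move=> q /QQ0; rewrite mem_filter mem_index_iota => /and3P[-> ->].
have b_gt0 := prod_pred_primes_gt0 Q_pr.
set b := (\prod_(_ <- _) _)%N in b_gt0 *.
apply: le_trans (usigma_upper R b_gt0); apply: ler_wpM2r => //.
rewrite lerD2l lerN2 (bigID (fun p => p <= z)%N) /=.
have tL_gt0 : 0 < 2 ^+ L :> R by rewrite exprn_gt0.
have small : \sum_(p <- primes b | (p <= z)%N) (p ^ logn p b)%:R^-1
    <= (2 ^+ L)^-1 :> R.
  apply: (@le_trans _ _ (\sum_(p <- primes b | (p <= z)%N)
      (2 ^+ L)^-1 * (p%:R ^+ 2)^-1)).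
    rewrite big_seq_cond [leRHS]big_seq_cond; apply: ler_sum => p.
    case/andP; rewrite mem_primes => /and3P[p_pr _ p_b] le_pz.
    have le_A : (A <= logn p b)%N.
      apply: leq_trans (count_dvd_leq_logn p_pr Q_pr).
      apply: QP; last exact: dvd_prod_pred_primes.
      by rewrite mem_filter p_pr mem_iota.
    have p_gt0 : 0 < p%:R :> R by rewrite ltr0n prime_gt0.
    rewrite -invfM lef_pV2 ?posrE ?mulr_gt0 ?exprn_gt0 ?ltr0n ?expn_gt0
      ?prime_gt0 //.
    rewrite -!natrX -natrM ler_nat.
    apply: (@leq_trans (p ^ A)); last by rewrite leq_pexp2l // prime_gt0.
    rewrite /A -(addn2 L) expnD leq_mul2r; apply/orP; right.
    by case: (L) => // k; rewrite leq_exp2r // prime_gt1.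
  rewrite -big_distrr /=; apply: ler_piMr; first by rewrite invr_ge0 ltW.
  rewrite -big_filter.
  apply: sum_inv_sqr_le1; first by rewrite filter_uniq ?primes_uniq.
  apply/allP => p; rewrite mem_filter mem_primes.
  by move=> /and4P[_ /prime_gt1].
have z_gt0 : 0 < z%:R :> R by rewrite ltr0n; lia.
have large : \sum_(p <- primes b | ~~ (p <= z)%N) (p ^ logn p b)%:R^-1
    <= K%:R / z%:R :> R.
  apply: (@le_trans _ _ (\sum_(p <- primes b | ~~ (p <= z)%N) z%:R^-1)).
    rewrite big_seq_cond [leRHS]big_seq_cond; apply: ler_sum => p.
    rewrite -ltnNge => /andP[p_b lt_zp].
    have p_gt0 : (0 < p)%N by apply: leq_ltn_trans lt_zp.
    rewrite lef_pV2 ?posrE ?z_gt0 ?ltr0n ?expn_gt0 ?p_gt0 // ler_nat.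
    rewrite (leq_trans (ltnW lt_zp)) //.
    by rewrite -{1}(expn1 p) leq_pexp2l // logn_gt0.
  rewrite big_const_seq iter_addr_0 -[leLHS]mulr_natl.
  apply: ler_wpM2r; first by rewrite invr_ge0 ltW.
  (* A prime p > z dividing [b] divides some q - 1 with q in [Q], so y < p < q < x and p lies in
     [Q0], which has [K] elements. *)
  rewrite ler_nat -size_Q0 -size_filter; apply: uniq_leq_size.
    by rewrite filter_uniq ?primes_uniq.
  move=> p; rewrite mem_filter -ltnNge => /andP[lt_zp].
  rewrite mem_primes => /and3P[p_pr _].
  move=> /(dvd_prod_pred_primes p_pr)/hasP[q qQ p_q].
  have := QQ0 _ qQ; rewrite !mem_filter !mem_index_iota => /and3P[q_pr _ lt_qx].
  have := dvdn_leq _ p_q; rewrite subn_gt0 prime_gt1 // p_pr => /(_ isT) le_pq.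
  by move: (prime_gt0 q_pr) => q_gt0; lia.
apply: le_trans (lerD small large) _.
have : K%:R / z%:R <= 2 / 2 ^+ L :> R.
  rewrite ler_pdivrMr // mulrAC ler_pdivlMr // -natrX -!natrM ler_nat /K mulSn.
  by rewrite mulnC in le_z; nia.
lra.
Qed.

Lemma exists_ratio_le (R : realType) N y (eps : R) : (0 < N)%N -> 0 < eps ->
  exists2 n, (y <= n)%N & usigma_uphi_ratio R n <= usigma_uphi_ratio R N + eps.
Proof.
move=> N_gt0 eps_gt0; set r := usigma_uphi_ratio R N.
have r_ge0 : 0 <= r by rewrite divr_ge0.
(* Chosen so that d = 3/2^L satisfies both d <= 1/2 and 2dr <= eps. *)
pose L := Num.bound (6 * r / eps + 6).
have lt_L : 6 * r / eps + 6 < 2 ^+ L by apply: upper_nthrootP.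
(* Primes above [N] do not divide [N]; being above [y], they also make c N >= y. *)
have [Q [Q_uniq Q_gt0 QP]] := exists_primes_usigma_prod_pred R L (y + N).
set b := (\prod_(q <- Q) (q - 1))%N => le_b.
pose c := (\prod_(q <- Q) q)%N.
have Q_pr : all prime Q by apply/allP => q /QP/andP[].
have b_gt0 : (0 < b)%N by apply: prod_pred_primes_gt0.
have le_bc : (b <= c)%N by apply: leq_prod => q _; apply: leq_subr.
have c_gt0 : (0 < c)%N by apply: leq_trans le_bc.
exists (c * N)%N.
  have [q qQ] : exists q, q \in Q.
    by case: (Q) Q_gt0 => // q ? _; exists q; rewrite mem_head.
  apply: leq_trans (leq_pmulr _ N_gt0); apply: (@leq_trans q).
    by have /andP[_ /ltnW] := QP q qQ; apply: leq_trans; apply: leq_addr.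
  by apply: dvdn_leq => //; rewrite /c (big_rem q qQ) dvdn_mulr.
rewrite /usigma_uphi_ratio uphiMprod_primes //; last first.
  by move=> q /QP/andP[-> lt_q]; rewrite (leq_ltn_trans (leq_addl y N)).
have N_gt0' : 0 < N%:R :> R by rewrite ltr0n.
have b_gt0' : 0 < b%:R :> R by rewrite ltr0n.
have tL_gt0 : 0 < 2 ^+ L :> R by rewrite exprn_gt0.
set d := 3 / 2 ^+ L in le_b.
have e6 : 6 * r / eps * eps = 6 * r by rewrite divfK ?gt_eqF.
have d_le : d <= 1 / 2.
  rewrite /d ler_pdivrMr //.
  have : 0 <= 6 * r / eps by rewrite divr_ge0 ?mulr_ge0 // ltW.
  lra.
have d_r : d * (2 * r) <= eps.
  rewrite /d mulrAC ler_pdivrMr //.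
  have : (6 * r / eps + 6) * eps <= 2 ^+ L * eps by rewrite ler_pM2r // ltW.
  by rewrite mulrDl e6; lra.
have d_ge0 : 0 <= d by rewrite divr_ge0 // ltW.
(* For 0 <= d <= 1/2, (1 + 2d)(1 - d) = 1 + d(1 - 2d) >= 1, so 1 + 2d replaces 1/(1 - d). *)
have le_usb : (usigma b)%:R <= (1 + 2 * d) * b%:R :> R.
  have : 0 <= d * (1 - 2 * d) * (usigma b)%:R by rewrite !mulr_ge0 //; lra.
  have : (1 + 2 * d) * ((1 - d) * (usigma b)%:R) <= (1 + 2 * d) * b%:R.
    by rewrite ler_wpM2l //; lra.
  nra.
have -> : r + eps = (r + eps) * (c * N)%:R / (c * N)%:R.
  by rewrite mulfK // pnatr_eq0 -lt0n muln_gt0 c_gt0.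
rewrite ler_wpM2r ?invr_ge0 //.
apply: (@le_trans _ _ ((usigma b)%:R * (usigma (uphi N))%:R)).
  by rewrite -natrM ler_nat usigma_submul ?uphi_gt0.
have -> : (usigma (uphi N))%:R = r * N%:R by rewrite divfK ?gt_eqF.
rewrite natrM mulrA mulrA ler_pM2r //.
apply: (@le_trans _ _ ((1 + 2 * d) * b%:R * r)); first by rewrite ler_wpM2r.
rewrite mulrAC; apply: ler_pM; rewrite ?ler_nat //.
  by rewrite mulr_ge0 //; lra.
by lra.
Qed.

(** * Passage to the lower limit *)

(** The lower limit is the supremum of the tail infima, and every tail contains a term at most
    [l]. *)
Lemma limn_einf_le_frequently (R : realType) (u : (\bar R)^nat) (l : \bar R) :
  (forall n, exists2 m, (n <= m)%N & (u m <= l)%E) -> (limn_einf u <= l)%E.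
Proof.
move=> ul; rewrite limn_einf_lim.
have := ereal_nondecreasing_cvgn (@nondecreasing_einfs _ u).
move=> /cvg_lim -> //; apply: ge_ereal_sup => _ [n _ <-].
have [m le_nm /(le_trans _)] := ul n; apply.
by apply: ereal_inf_lbound; exists m.
Qed.

(** Common source of both claims, with [N] equal to m/2 or to [fermat_product]. *)
Lemma limn_einf_ratio_le (R : realType) N : (0 < N)%N ->
  (limn_einf (fun n => (usigma_uphi_ratio R n)%:E)
    <= (usigma_uphi_ratio R N)%:E)%E.
Proof.
move=> N_gt0; apply/lee_addgt0Pr => e e_gt0.
apply: limn_einf_le_frequently => n.
have [m le_nm le_r] := exists_ratio_le n N_gt0 e_gt0.
by exists m; rewrite // -EFinD lee_fin.
Qed.

(** * Fermat primes and the explicit bound *)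

(* The final factor 1 makes the evaluation below a uniform recursion. *)
Definition fermat_product :=
  (2 * ((2 ^ 16).+1 * ((2 ^ 8).+1 *
    ((2 ^ 4).+1 * ((2 ^ 2).+1 * ((2 ^ 1).+1 * 1))))))%N.

(** Each Fermat prime exceeds the product of the smaller ones, hence does not divide it, and
    contributes 2^k to [uphi]; the exponents 1, 2, 4, 8, 16 sum to 31, and the factor 2 contributes
    1. *)
Lemma uphi_fermat_product : uphi fermat_product = (2 ^ 31)%N.
Proof.
have peel k n l : (0 < k)%N -> odd n /\ uphi n = (2 ^ l)%N ->
    prime (2 ^ k).+1 && (n < (2 ^ k).+1)%N ->
    odd ((2 ^ k).+1 * n) /\ uphi ((2 ^ k).+1 * n) = (2 ^ (k + l))%N.
  move=> k_gt0 [n_odd n_phi] /andP[q_pr lt_n].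
  rewrite oddM n_odd oddS oddX orbF -lt0n k_gt0.
  by rewrite uphiMprime ?subn1 ?gtnNdvd ?odd_gt0 //= n_phi expnD.
have one : odd 1 /\ uphi 1 = (2 ^ 0)%N by rewrite /uphi big_nil.
have /(_ ltac:(vm_compute; reflexivity)) step1 := peel 1 _ _ isT one.
have /(_ ltac:(vm_compute; reflexivity)) step2 := peel 2 _ _ isT step1.
have /(_ ltac:(vm_compute; reflexivity)) step4 := peel 4 _ _ isT step2.
have /(_ ltac:(vm_compute; reflexivity)) step8 := peel 8 _ _ isT step4.
have /(_ ltac:(vm_compute; reflexivity)) step16 := peel 16 _ _ isT step8.
have double n l : odd n /\ uphi n = (2 ^ l)%N -> uphi (2 * n) = (2 ^ l)%N.
  by case=> n_odd <-; rewrite uphiMprime ?odd_gt0 ?dvdn2 ?n_odd // mul1n.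
exact: double step16.
Qed.

(** Repeated use of (2^k - 1)(2^k + 1) = 2^(2k) - 1, starting from 1 = 2^1 - 1. *)
Lemma natr_fermat_product (R : comPzRingType) :
  fermat_product%:R = 2 * (2 ^+ 32 - 1) :> R.
Proof.
have peel k n : n%:R = 2 ^+ k - 1 :> R ->
    ((2 ^ k).+1 * n)%:R = 2 ^+ (k + k) - 1 :> R.
  move=> n_val; rewrite natrM -addn1 natrD natrX n_val mulrC.
  by rewrite -subr_sqr_1 -exprM muln2 addnn.
have one : 1%:R = 2 ^+ 1 - 1 :> R by rewrite expr1 mulr2n addrK.
have n_val := peel _ _ (peel _ _ (peel _ _ (peel _ _ (peel _ _ one)))).
by rewrite (natrM _ 2) n_val.
Qed.

Lemma fermat_product_gt0 : (0 < fermat_product)%N.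
Proof.
by rewrite -(ltr0n int) natr_fermat_product mulr_gt0 ?subr_gt0 ?exprn_egt1.
Qed.

Lemma ratio_fermat_product (R : realType) :
  usigma_uphi_ratio R fermat_product = 1 / 4 + 3 / (4 * (2 ^+ 32 - 1)).
Proof.
have usigma_pow2 k : (0 < k)%N -> (usigma (2 ^ k))%:R = 2 ^+ k + 1 :> R.
  by move=> k_gt0; rewrite usigma_prime_pow // natrD natrX.
rewrite /usigma_uphi_ratio uphi_fermat_product usigma_pow2 //.
rewrite natr_fermat_product.
have : 1 < 2 ^+ 31 :> R by rewrite exprn_egt1 // ltr1n.
(* With x = 2^31 the claim reads (x + 1)/(2(2x - 1)) = 1/4 + 3/(4(2x - 1)). *)
rewrite (exprS 2 31); move: (2 ^+ 31) => x x_gt1.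
by field; rewrite gt_eqF //; lra.
Qed.

Theorem theorem8 (R : realType) :
  (limn_einf (fun n : nat => (usigma_uphi_ratio R n)%:E) <=
   ereal_inf [set (usigma_uphi_ratio R (m %/ 2)%N)%:E | m in
     [set m : nat | [/\ (0 < m)%N, ~~ odd m &
                        forall l : nat, (2 <= l)%N -> m <> (2 ^ l)%N]]])%E
  /\
  (limn_einf (fun n : nat => (usigma_uphi_ratio R n)%:E) <=
   (1 / 4 + 3 / (4 * (2 ^+ 32 - 1)) : R)%:E)%E.
Proof.
split; last first.
  rewrite -ratio_fermat_product.
  exact/limn_einf_ratio_le/fermat_product_gt0.
apply/ereal_infP => _ [m [m_gt0 m_even _] <-].
by apply: limn_einf_ratio_le; lia.
Qed.
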